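(* Let $m$ be a positive integer and $\lambda$ a nonzero real number. Then, as formal power series in $t$, $$e_{\lambda}(t)\,\frac{1}{1-x\left(\frac{e_{\lambda}^{m}(t)-1}{m}\right)}=\sum_{n=0}^{\infty}\mathcal{F}_{m,\lambda}(n,x)\frac{t^{n}}{n!}.$$
   Context: For a nonzero real $\lambda$: $(x)_{0,\lambda}=1$, $(x)_{n,\lambda}=x(x-\lambda)\cdots(x-(n-1)\lambda)$; $(x)_n=(x)_{n,1}$; $e_\lambda^x(t)=(1+\lambda t)^{x/\lambda}$, $e_\lambda(t)=e_\lambda^1(t)$. Degenerate Whitney numbers of the second kind $W_{m,\lambda}(n,k)$: $(mx+1)_{n,\lambda}=\sum_{k=0}^{n}W_{m,\lambda}(n,k)m^{k}(x)_{k}$. Degenerate Tanny–Dowling polynomials: $\mathcal{F}_{m,\lambda}(n,x)=\sum_{k=0}^{n}k!\,W_{m,\lambda}(n,k)x^{k}$ (equivalently $\int_0^\infty D_{m,\lambda}(n,x\xi)e^{-\xi}d\xi$ with $D_{m,\lambda}(n,x)=\sum_k W_{m,\lambda}(n,k)x^k$). *)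

(* Defs.v *)
From HB Require Import structures.
From mathcomp Require Import all_boot all_order all_algebra.
From mathcomp Require Import ring boolp reals.

Set Implicit Arguments.
Unset Strict Implicit.
Unset Printing Implicit Defensive.

Import Order.TTheory GRing.Theory Num.Theory.
Local Open Scope ring_scope.

(* Formal power series in t; [coefs f n] is the coefficient of t^n.  This is a
   record rather than [nat -> A] because functions already carry the pointwise
   ring structure. *)
Record fps (A : Type) := Fps { coefs : nat -> A }.

Notation "{ 'fps' A }" := (fps A) (at level 0, format "{ 'fps'  A }").

HB.instance Definition _ (A : Type) := [isNew for @coefs A].
HB.instance Definition _ (A : eqType) := [Equality of fps A by <:].
HB.instance Definition _ (A : choiceType) := [Choice of fps A by <:].

Lemma fpsP (A : Type) (f g : {fps A}) : coefs f =1 coefs g <-> f = g.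
Proof. by split=> [|-> //]; case: f g => [f] [g] /= /funext ->. Qed.

Definition map_fps (A B : Type) (h : A -> B) (f : {fps A}) : {fps B} :=
  Fps (fun n => h (coefs f n)).

Section FpsRing.
Variable A : comUnitRingType.
Implicit Types (f g h : {fps A}) (c : A).

Definition fpsC c : {fps A} := Fps (fun n => if n is 0 then c else 0).
Definition fps_opp f : {fps A} := Fps (fun n => - coefs f n).
Definition fps_add f g : {fps A} := Fps (fun n => coefs f n + coefs g n).
Definition fps_mul f g : {fps A} :=
  Fps (fun n => \sum_(i < n.+1) coefs f i * coefs g (n - i)).

Fact fps_addA : associative fps_add.
Proof. by move=> f g h; apply/fpsP => n /=; rewrite addrA. Qed.
Fact fps_addC : commutative fps_add.
Proof. by move=> f g; apply/fpsP => n /=; rewrite addrC. Qed.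
Fact fps_add0 : left_id (fpsC 0) fps_add.
Proof. by move=> f; apply/fpsP => -[|n] /=; rewrite add0r. Qed.
Fact fps_addN : left_inverse (fpsC 0) fps_opp fps_add.
Proof. by move=> f; apply/fpsP => -[|n] /=; rewrite addNr. Qed.

HB.instance Definition _ :=
  GRing.isZmodule.Build (fps A) fps_addA fps_addC fps_add0 fps_addN.

Fact fps_mulC : commutative fps_mul.
Proof.
move=> f g; apply/fpsP => n /=; rewrite (reindex_inj rev_ord_inj) /=.
by apply: eq_bigr => i _; rewrite mulrC subSS subKn // -ltnS.
Qed.

Fact fps_mulA : associative fps_mul.
Proof.
move=> f g h; apply/fpsP => n /=.
pose F j k := coefs f j * (coefs g k * coefs h (n - j - k)%N).
transitivity (\sum_(j < n.+1) \sum_(k < n.+1 | (k <= n - j)%N) F j k).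
  apply: eq_bigr => j _; rewrite big_distrr /=.
  by rewrite (big_ord_narrow_leq (leq_subr _ _)).
transitivity (\sum_(j < n.+1) \sum_(i < n.+1 | (j <= i)%N) F j (i - j)%N).
  apply: eq_bigr => j _.
  have jn : (j <= n)%N by rewrite -ltnS.
  rewrite -(big_mkord (fun k => (k <= n - j)%N) (F j)).
  rewrite -(big_mkord (fun i => (j <= i)%N) (fun i => F j (i - j)%N)).
  rewrite [RHS](@big_cat_nat _ _ _ j) //=; last exact: leqW.
  rewrite [X in _ = X + _]big_nat_cond [X in _ = X + _]big_pred0 ?add0r; last first.
    by move=> i /=; case: (ltnP i j) => ij; rewrite ?andbF.
  rewrite [LHS](@big_cat_nat _ _ _ (n - j).+1) //=; last by rewrite ltnS leq_subr.
  rewrite [X in _ + X = _]big_nat_cond [X in _ + X = _]big_pred0 ?addr0; last first.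
    by move=> i /=; case: (ltnP (n - j) i) => ij; rewrite ?andbF.
  rewrite -[X in _ = \big[_/_]_(X <= _ < _ | _) _]add0n big_addn subSn // [LHS]big_nat_cond [RHS]big_nat_cond.
  apply: eq_big => [i|i _]; last by rewrite addnK.
  by rewrite leq_addl leq0n /= ltnS; case: leqP.
rewrite (exchange_big_dep predT) //=; apply: eq_bigr => i _.
rewrite big_distrl /= (big_ord_narrow_leq (n1 := i)); first by rewrite -ltnS.
move=> iLn; apply: eq_bigr => j _; rewrite /F /= mulrA; congr (_ * coefs h _).
by have := ltn_ord j; rewrite ltnS => ji; rewrite -subnDA subnKC.
Qed.

Fact fps_mul1 : left_id (fpsC 1) fps_mul.
Proof.
move=> f; apply/fpsP => n /=; rewrite big_ord_recl /= mul1r subn0.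
by rewrite big1 ?addr0 // => i _; rewrite mul0r.
Qed.

Fact fps_mulDl : left_distributive fps_mul fps_add.
Proof.
move=> f g h; apply/fpsP => n /=; rewrite -big_split /=.
by apply: eq_bigr => i _; rewrite mulrDl.
Qed.

Fact fps_oner_neq0 : fpsC 1 != 0.
Proof.
apply/eqP => /fpsP /(_ 0%N) /= /eqP; apply/negP; exact: oner_neq0.
Qed.

HB.instance Definition _ := GRing.Zmodule_isComNzRing.Build (fps A)
  fps_mulA fps_mulC fps_mul1 fps_mulDl fps_oner_neq0.

Definition fps_unit : pred {fps A} := fun f => coefs f 0 \is a GRing.unit.

(* The first n coefficients of 1/f:
   b_0 = a_0^-1 and b_k = - a_0^-1 * (a_1 b_(k-1) + ... + a_k b_0). *)
Fixpoint fps_inv_seq f n : seq A :=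
  if n is k.+1 then
    let s := fps_inv_seq f k in
    rcons s ((coefs f 0)^-1 *
      ((k == 0%N)%:R - \sum_(i < k) coefs f i.+1 * nth 0 s (k - i.+1)))
  else [::].

Definition fps_inv f : {fps A} :=
  if fps_unit f then Fps (fun n => nth 0 (fps_inv_seq f n.+1) n) else f.

Lemma size_fps_inv_seq f n : size (fps_inv_seq f n) = n.
Proof. by elim: n => //= n IHn; rewrite size_rcons IHn. Qed.

Lemma nth_fps_inv_seq f n i : (i < n)%N ->
  nth 0 (fps_inv_seq f n) i = nth 0 (fps_inv_seq f i.+1) i.
Proof.
elim: n => // n IHn; rewrite ltnS leq_eqVlt => /predU1P[-> //|lt_in].
by rewrite [LHS]/= nth_rcons size_fps_inv_seq lt_in IHn.
Qed.

Fact fps_mulV : {in fps_unit, left_inverse 1 fps_inv *%R}.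
Proof.
move=> f fU; have fU0 : fps_unit f := fU.
rewrite [_ * _]fps_mulC /fps_inv fU0.
apply/fpsP => n /=; rewrite big_ord_recl subn0.
rewrite nth_rcons size_fps_inv_seq ltnn eqxx mulVKr //.
rewrite [X in _ - X](_ : _ = \sum_(i < n) coefs f (lift ord0 i) *
   nth 0 (fps_inv_seq f (n - lift ord0 i).+1) (n - lift ord0 i)).
  by rewrite subrK; case: n.
apply: eq_bigr => i _; congr (_ * _).
by rewrite lift0 nth_fps_inv_seq // ltn_subrL (leq_ltn_trans _ (ltn_ord i)).
Qed.

Fact fps_unitPl f g : g * f = 1 -> fps_unit f.
Proof.
move=> /fpsP /(_ 0%N) /=; rewrite big_ord1 => gf1.
by apply/unitrPr; exists (coefs g 0); rewrite mulrC.
Qed.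

Fact fps_inv_out : {in [predC fps_unit], fps_inv =1 id}.
Proof. by move=> f fN; rewrite /fps_inv (negbTE (fN : ~~ fps_unit f)). Qed.

HB.instance Definition _ := GRing.ComNzRing_hasMulInverse.Build (fps A)
  fps_mulV fps_unitPl fps_inv_out.

End FpsRing.

(* (x)_{n,a} = x (x - a) ... (x - (n-1) a) *)
Definition dfact (A : comNzRingType) (a x : A) (n : nat) : A :=
  \prod_(i < n) (x - i%:R * a).

(* (1 + c t)^a, as the binomial series sum_n (a)_n / n! * (c t)^n *)
Definition fps_binpow (F : fieldType) (c a : F) : {fps F} :=
  Fps (fun n => dfact 1 a n / n`!%:R * c ^+ n).

(* e_lambda^y(t) = (1 + lambda t)^(y / lambda) *)
Definition dexp (F : fieldType) (lambda y : F) : {fps F} :=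
  fps_binpow lambda (y / lambda).

(* Defining identity of the degenerate Whitney numbers of the second kind,
   the variable x being the indeterminate 'X. *)
Definition whitney2_spec (F : fieldType) (m : nat) (lambda : F)
    (W : nat -> nat -> F) : Prop :=
  forall n : nat,
    dfact lambda%:P (m%:R * 'X + 1) n =
    \sum_(k < n.+1) (W n k * m%:R ^+ k) *: dfact 1 'X k :> {poly F}.

Lemma whitney2_exists (F : fieldType) (m : nat) (lambda : F) :
  exists W : nat -> nat -> F, whitney2_spec m lambda W /\
    forall n k : nat, (n < k)%N -> W n k = 0.
Proof.
pose fix W (n k : nat) {struct n} : F := if n is p.+1 then
    (if k is j.+1 then W p j else 0)
      + (m%:R * k%:R + 1 - p%:R * lambda) * W p k
  else (k == 0%N)%:R.
have W0 n k : (n < k)%N -> W n k = 0.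
  elim: n k => [|n IHn] [|k] //= ltnk.
  by rewrite !IHn ?mulr0 ?addr0 // ltnW.
exists W; split=> // n; elim: n => [|n IHn].
  by rewrite big_ord1 /dfact !big_ord0 mulr1 scale1r.
rewrite {1}/dfact big_ord_recr -/(dfact _ _ _) IHn /=.
have D k : (dfact 1 'X k : {poly F}) * (m%:R * 'X + 1 - n%:R * lambda%:P) =
    m%:R *: dfact 1 'X k.+1
    + (m%:R * k%:R + 1 - n%:R * lambda) *: dfact 1 'X k.
  rewrite {2}/dfact big_ord_recr -/(dfact _ _ _) /= -!mul_polyC.
  rewrite !rmorphD /= !rmorphN /= !rmorphM /= !rmorph_nat rmorph1; ring.
rewrite big_distrl /=.
under eq_bigr => k _ do rewrite -scalerAl D scalerDr !scalerA.
rewrite big_split /=.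
transitivity (\sum_(k < n.+2)
   (((if k : nat is j.+1 then W n j else 0) * m%:R ^+ k) *: dfact 1 'X k
   + (W n k * m%:R ^+ k * (m%:R * k%:R + 1 - n%:R * lambda)) *: dfact 1 'X k)
   : {poly F}); last first.
  apply: eq_bigr => k _; rewrite -scalerDl; congr (_ *: _).
  by rewrite mulrDl; congr (_ + _); rewrite [LHS]mulrC mulrA.
rewrite big_split /=; congr (_ + _); last first.
  by rewrite [RHS]big_ord_recr /= W0 // !mul0r scale0r addr0.
rewrite [RHS]big_ord_recl /= mul0r scale0r add0r.
by apply: eq_bigr => k _; rewrite -mulrA -exprSr.
Qed.

(* W_{m,lambda}(n,k), extended by 0 to k > n. *)
Definition whitney2 (F : fieldType) (m : nat) (lambda : F) : nat -> nat -> F :=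
  projT1 (cid (whitney2_exists m lambda)).

Lemma whitney2P (F : fieldType) (m : nat) (lambda : F) :
  whitney2_spec m lambda (whitney2 m lambda).
Proof. by rewrite /whitney2; case: cid => W []. Qed.

Lemma whitney2_unique (F : fieldType) (m : nat) (lambda : F)
    (W V : nat -> nat -> F) : m%:R != 0 :> F ->
  whitney2_spec m lambda W -> whitney2_spec m lambda V ->
  forall n k : nat, (k <= n)%N -> W n k = V n k.
Proof.
move=> m0 HW HV n.
have mon k : (dfact 1 'X k : {poly F}) \is monic /\
    size (dfact 1 'X k : {poly F}) = k.+1.
  elim: k => [|k [IHm IHs]]; first by rewrite /dfact big_ord0 monic1 size_poly1.
  rewrite /dfact big_ord_recr -/(dfact _ _ _) /= mulr1 -polyC_natr.
  by rewrite monicMr ?monicXsubC // size_Mmonic ?monicXsubC ?monic_neq0 //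
    size_XsubC IHs addn2.
have free N (c : nat -> F) : \sum_(k < N) c k *: dfact 1 'X k = 0 :> {poly F} ->
    forall k, (k < N)%N -> c k = 0.
  elim: N => // N IHN; rewrite big_ord_recr /= => S0.
  have cN : c N = 0.
    have := congr1 (fun p : {poly F} => p`_N) S0.
    rewrite coefD coefZ coef0 [X in X + _]nth_default ?add0r.
      have [/monicP] := mon N; rewrite /lead_coef => + sN.
      by rewrite sN /= => ->; rewrite mulr1.
    apply: (leq_trans (size_sum _ _ _)); apply/bigmax_leqP => i _.
    by rewrite (leq_trans (size_scale_leq _ _)) // (mon i).2.
  move=> k; rewrite ltnS leq_eqVlt => /predU1P[-> //|].
  by apply: IHN; move: S0; rewrite cN scale0r addr0.
move=> k le_kn; apply: (mulIf (expf_neq0 k m0)); apply/eqP.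
rewrite -subr_eq0; apply/eqP.
apply: (free n.+1 (fun k => W n k * m%:R ^+ k - V n k * m%:R ^+ k)) => //.
under eq_bigr do rewrite scalerBl.
by rewrite sumrB -HW -HV subrr.
Qed.

(* F_{m,lambda}(n,x), as a polynomial in the indeterminate x. *)
Definition tanny_dowling (F : fieldType) (m : nat) (lambda : F) (n : nat) :
    {poly F} :=
  \sum_(k < n.+1) (k`!%:R * whitney2 m lambda n k) *: 'X^k.

(* Main.v *)
(** Write u = (e_lambda^m - 1) / m.  For every natural number j,
    e_lambda^(m j + 1) = e_lambda (1 + m u)^j, and extracting the coefficient
    of t^n shows that n!/k! [t^n] (e_lambda u^k) satisfies the defining identity
    of W_{m,lambda}(n,k) at x = j.  Both sides of that identity are polynomials
    in x, so it holds identically, and the numbers W_{m,lambda}(n,k) are these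
    coefficients.  Hence the coefficient of x^k in the generating function of
    the Tanny-Dowling polynomials is e_lambda u^k; sum the geometric series. *)

Require Import Defs.
From HB Require Import structures.
From mathcomp Require Import all_boot all_order all_algebra.
From mathcomp Require Import ring reals.
Set Implicit Arguments.
Unset Strict Implicit.
Unset Printing Implicit Defensive.

Import Order.TTheory GRing.Theory Num.Theory.
Local Open Scope ring_scope.

(** * Coefficients of power series and the order of a power *)

Section FpsCoefs.
Context {A : comUnitRingType}.
Implicit Types (f g : {fps A}) (c : A).

Lemma coefs1 n : coefs (1 : {fps A}) n = (n == 0%N)%:R.
Proof. by case: n. Qed.

Lemma coefsB f g n : coefs (f - g) n = coefs f n - coefs g n.
Proof. by []. Qed.

Lemma coefsM f g n :
  coefs (f * g) n = \sum_(i < n.+1) coefs f i * coefs g (n - i).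
Proof. by []. Qed.

Lemma coefs_sum (I : Type) (r : seq I) (P : pred I) (F : I -> {fps A}) n :
  coefs (\sum_(i <- r | P i) F i) n = \sum_(i <- r | P i) coefs (F i) n.
Proof. by elim/big_rec2: _ => [|i c f _ <-] //; case: n. Qed.

Lemma coefsMn f k n : coefs (f *+ k) n = coefs f n *+ k.
Proof.
elim: k => [|k IHk]; first by rewrite !mulr0n; case: n.
by rewrite !mulrS -IHk.
Qed.

(** In [f * f ^+ k] the term at index 0 dies with the constant term of [f], and every other term
    meets a coefficient of [f ^+ k] of smaller index: [f ^+ k] has order at least [k]. *)
Lemma coefs_lt_exp f n k : coefs f 0 = 0 -> (n < k)%N -> coefs (f ^+ k) n = 0.
Proof.
move=> f0; elim: k n => // k IHk n; rewrite ltnS => le_nk.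
rewrite exprS coefsM big1 // => -[[|i] lt_in] _ /=; first by rewrite f0 mul0r.
by rewrite IHk ?mulr0 // (leq_trans _ le_nk) // ltn_subrL (leq_trans _ (lt_in : (i < n)%N)).
Qed.

Lemma coefs_lt_mul_exp f g n k :
  coefs f 0 = 0 -> (n < k)%N -> coefs (g * f ^+ k) n = 0.
Proof.
move=> f0 lt_nk; rewrite coefsM big1 // => i _.
by rewrite coefs_lt_exp ?mulr0 // (leq_ltn_trans (leq_subr _ _)).
Qed.

Lemma fps_unitE f : (f \is a GRing.unit) = (coefs f 0 \is a GRing.unit).
Proof. by []. Qed.

End FpsCoefs.

(** * Coefficientwise maps, and power series over polynomials in x *)

Section MapFps.
Variables (A B : comUnitRingType) (h : {rmorphism A -> B}).

Fact map_fps_zmod_morphism : zmod_morphism (map_fps h).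
Proof. by move=> f g; apply/fpsP => n /=; rewrite rmorphB. Qed.

Fact map_fps_monoid_morphism : monoid_morphism (map_fps h).
Proof.
split=> [|f g]; apply/fpsP => n.
  by rewrite -[LHS]/(h (coefs 1 n)) !coefs1 rmorph_nat.
by rewrite /= rmorph_sum; apply: eq_bigr => i _; rewrite rmorphM.
Qed.

HB.instance Definition _ :=
  GRing.isZmodMorphism.Build {fps A} {fps B} (map_fps h) map_fps_zmod_morphism.
HB.instance Definition _ :=
  GRing.isMonoidMorphism.Build {fps A} {fps B} (map_fps h)
    map_fps_monoid_morphism.

End MapFps.

Section CoefX.
Variable A : idomainType.
Implicit Types (f g : {fps {poly A}}) (u : {fps A}) (k : nat).

(** Taking the coefficient of x^k is additive but in general not multiplicative, so the ring
    morphism structure on [map_fps] does not cover it. *)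
Lemma map_coefpB k f g :
  map_fps (coefp k) (f - g) = map_fps (coefp k) f - map_fps (coefp k) g.
Proof. by apply/fpsP => n /=; rewrite coefB. Qed.

Lemma map_coefp_polyC k u :
  map_fps (coefp k) (map_fps polyC u) = if k is 0 then u else 0.
Proof. by apply/fpsP => n /=; rewrite coefC; case: k n => [|k] [|n]. Qed.

Lemma map_coefpMC k f u :
  map_fps (coefp k) (f * map_fps polyC u) = map_fps (coefp k) f * u.
Proof.
apply/fpsP => n /=; rewrite coef_sum.
by apply: eq_bigr => i _; rewrite coefMC.
Qed.

Lemma map_coefpXM k f :
  map_fps (coefp k) (fpsC 'X * f) =
  if k is j.+1 then map_fps (coefp j) f else 0.
Proof.
apply/fpsP => n /=; rewrite big_ord_recl subn0 big1 ?addr0 => [|i _]; last first.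
  by rewrite mul0r.
by rewrite coefXM; case: k n => [|k] [|n].
Qed.

Lemma fps_poly_eq f g :
  (forall k, map_fps (coefp k) f = map_fps (coefp k) g) -> f = g.
Proof.
by move=> fg; apply/fpsP => n; apply/polyP => k; have /fpsP /(_ n) := fg k.
Qed.

End CoefX.

(** * Falling factorials, evaluation at naturals, coefficient recurrences *)

Lemma dfactS (A : comNzRingType) (a x : A) n :
  dfact a x n.+1 = dfact a x n * (x - n%:R * a).
Proof. by rewrite /dfact big_ord_recr. Qed.

Lemma dfact0 (A : comNzRingType) (a x : A) : dfact a x 0 = 1.
Proof. by rewrite /dfact big_ord0. Qed.

Lemma dfact_nat (A : comNzRingType) j k : dfact (1 : A) j%:R k = (j ^_ k)%:R.
Proof.
elim: k => [|k IHk]; first by rewrite dfact0.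
rewrite dfactS IHk mulr1 ffactnSr natrM.
(* For [k > j] the truncated difference [j - k] does not match the ring subtraction, but then
   [j ^_ k] is already 0. *)
have [le_kj|lt_jk] := leqP k j; first by rewrite natrB.
by rewrite ffact_small // !mul0r.
Qed.

Lemma horner_dfact (A : comNzRingType) (a p : {poly A}) n x :
  (dfact a p n).[x] = dfact a.[x] p.[x] n.
Proof.
rewrite /dfact horner_prod; apply: eq_bigr => i _.
by rewrite hornerD hornerN hornerM -polyC_natr hornerC.
Qed.

(** The difference [r] vanishes at 0, ..., [size r - 1], which are distinct in characteristic 0: too
    many roots for a nonzero polynomial. *)
Lemma poly_eq_nat (F : numDomainType) (p q : {poly F}) :
  (forall j : nat, p.[j%:R] = q.[j%:R]) -> p = q.
Proof.
move=> pq; apply/eqP; rewrite -subr_eq0; apply/eqP.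
pose r := p - q; apply: (@roots_geq_poly_eq0 _ r [seq j%:R | j <- iota 0 (size r)]).
- by apply/allP => _ /mapP[j _ ->]; rewrite rootE !hornerE pq subrr.
- by rewrite map_inj_uniq ?iota_uniq //; apply: mulrIn; rewrite oner_eq0.
- by rewrite size_map size_iota.
Qed.

(* Split the factor [n.+1] as [i + (n.+1 - i)] in the [i]-th term. *)
Lemma coefsM_recurrence (A : comUnitRingType) (f g : {fps A}) (a x y : A) :
  (forall n, n.+1%:R * coefs f n.+1 = (x - n%:R * a) * coefs f n) ->
  (forall n, n.+1%:R * coefs g n.+1 = (y - n%:R * a) * coefs g n) ->
  forall n, n.+1%:R * coefs (f * g) n.+1 =
    (x + y - n%:R * a) * coefs (f * g) n.
Proof.
move=> fS gS n; rewrite !coefsM !mulr_sumr.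
transitivity (\sum_(i < n.+2) i%:R * coefs f i * coefs g (n.+1 - i)
            + \sum_(i < n.+2) coefs f i * ((n.+1 - i)%:R * coefs g (n.+1 - i))).
  rewrite -big_split; apply: eq_bigr => i _ /=.
  have le_in : (i <= n.+1)%N by rewrite -ltnS.
  by rewrite (natrB _ le_in); ring.
rewrite [X in X + _ = _]big_ord_recl !mul0r add0r.
rewrite [X in _ + X = _]big_ord_recr /= subnn mul0r mulr0 addr0 -big_split.
apply: eq_bigr => i _ /=.
have le_in : (i <= n)%N by rewrite -ltnS.
by rewrite /bump subSS (subSn le_in) fS gS (natrB _ le_in); ring.
Qed.

(** * The degenerate exponential and its addition law *)

Section DegenerateExponential.
Variables (F : numFieldType) (lambda : F).
Hypothesis lambda_neq0 : lambda != 0.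
Implicit Types (x y : F) (n : nat).

Lemma fact_neq0 n : n`!%:R != 0 :> F.
Proof. by rewrite pnatr_eq0 -lt0n fact_gt0. Qed.

(** Each factor of the falling factorial absorbs one [lambda]: [lambda * (y / lambda - i) = y - i *
    lambda]. *)
Lemma coefs_dexp y n : coefs (dexp lambda y) n = dfact lambda y n / n`!%:R.
Proof.
rewrite /= mulrAC; congr (_ / _); elim: n => [|n IHn].
  by rewrite !dfact0 mulr1.
by rewrite !dfactS -IHn exprS; field.
Qed.

(** Coefficient form of the differential equation (1 + lambda t) f' = y f. *)
Lemma coefs_dexpS y n :
  n.+1%:R * coefs (dexp lambda y) n.+1 =
  (y - n%:R * lambda) * coefs (dexp lambda y) n.
Proof.
rewrite !coefs_dexp dfactS factS natrM; field.
by rewrite fact_neq0 addrC natr1 pnatr_eq0.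
Qed.

Lemma coefs_dexp0 y : coefs (dexp lambda y) 0 = 1.
Proof. by rewrite coefs_dexp dfact0 divr1. Qed.

Lemma dexp0 : dexp lambda 0 = 1.
Proof.
apply/fpsP => -[|n]; first by rewrite coefs_dexp0.
by rewrite coefs_dexp /dfact big_ord_recl mul0r subr0 !mul0r.
Qed.

(** Both sides have constant term 1 and obey the same first-order recurrence, which determines all
    coefficients because [n.+1] is invertible. *)
Lemma dexpD x y : dexp lambda (x + y) = dexp lambda x * dexp lambda y.
Proof.
apply/fpsP; elim=> [|n IHn].
  by rewrite coefsM big_ord1 !coefs_dexp0 mulr1.
have n1 : n.+1%:R != 0 :> F by rewrite pnatr_eq0.
apply: (mulfI n1); rewrite coefs_dexpS IHn.
by rewrite (coefsM_recurrence (coefs_dexpS x) (coefs_dexpS y)).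
Qed.

Lemma dexpMn y j : dexp lambda (y *+ j) = dexp lambda y ^+ j.
Proof.
by elim: j => [|j IHj]; rewrite ?mulr0n ?dexp0 // mulrS dexpD IHj exprS.
Qed.

End DegenerateExponential.

(** * Whitney numbers as coefficients of e_lambda u^k *)

Section WhitneyCoefs.
Variables (F : numFieldType) (m : nat) (lambda : F).
Hypotheses (m_gt0 : (0 < m)%N) (lambda_neq0 : lambda != 0).

Lemma natr_fps_unit {A : comUnitRingType} :
  (m%:R : A) \is a GRing.unit -> (m%:R : {fps A}) \is a GRing.unit.
Proof. by rewrite fps_unitE coefsMn coefs1. Qed.

Let m_unit : (m%:R : F) \is a GRing.unit.
Proof. by rewrite unitfE pnatr_eq0 -lt0n. Qed.

Let u : {fps F} := (dexp lambda m%:R - 1) / m%:R.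

Lemma dexp_quotient_coefs0 : coefs u 0 = 0.
Proof.
(* Comparing constant terms after clearing the denominator avoids computing the inverse series of
   [m]. *)
have /fpsP /(_ 0%N) : u * m%:R = dexp lambda m%:R - 1.
  by rewrite divrK // natr_fps_unit.
rewrite coefsB coefs_dexp0 // coefs1 subrr mulr_natr coefsMn => /eqP.
by rewrite mulrn_eq0 eqn0Ngt m_gt0 => /eqP.
Qed.

Lemma dfact_dexp_quotient j n :
  dfact lambda (m%:R * j%:R + 1) n =
  n`!%:R * \sum_(k < n.+1)
    m%:R ^+ k * 'C(j, k)%:R * coefs (dexp lambda 1 * u ^+ k) n.
Proof.
have -> : dfact lambda (m%:R * j%:R + 1) n =
    n`!%:R * coefs (dexp lambda (1 + m%:R *+ j)) n.
  by rewrite coefs_dexp // [RHS]mulrC divfK ?fact_neq0 // mulr_natr addrC.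
have Eu : dexp lambda m%:R = u * m%:R + 1.
  by rewrite divrK ?subrK // natr_fps_unit.
congr (_ * _); rewrite dexpD // dexpMn // Eu exprD1n mulr_sumr coefs_sum.
pose G k := m%:R ^+ k * 'C(j, k)%:R * coefs (dexp lambda 1 * u ^+ k) n.
(* The binomial theorem sums up to [j], the Whitney identity up to [n]. Terms beyond either bound
   vanish, by the binomial coefficient or by the order of [u ^+ k], so the bounds can be
   exchanged. *)
have G0 k : (n < k)%N || (j < k)%N -> G k = 0.
  rewrite /G => /orP[lt_nk|lt_jk]; last by rewrite bin_small // mulr0 mul0r.
  by rewrite coefs_lt_mul_exp ?mulr0 // dexp_quotient_coefs0.
transitivity (\sum_(0 <= k < j.+1) G k).
  rewrite big_mkord; apply: eq_bigr => k _.
  rewrite exprMn -natrX mulr_natr -mulrnA mulrnAr coefsMn.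
  by rewrite /G -[LHS]mulr_natl natrM natrX.
transitivity (\sum_(0 <= k < n.+1) G k); last by rewrite big_mkord.
have trunc a b : (a <= b)%N -> (forall k, (a < k)%N -> G k = 0) ->
    \sum_(0 <= k < b.+1) G k = \sum_(0 <= k < a.+1) G k.
  move=> le_ab Ga; rewrite (@big_cat_nat _ _ _ a.+1) //= [X in _ + X]big1_seq.
    by rewrite addr0.
  by move=> k; rewrite mem_index_iota => /andP[_ /andP[/Ga]].
have [le_jn|/ltnW le_nj] := leqP j n; [apply/esym|];
  by apply: trunc => // k lt_k; rewrite G0 // lt_k ?orbT.
Qed.

Lemma coefs_dexp_whitney2 n k : (k <= n)%N ->
  coefs (dexp lambda 1 * u ^+ k) n = k`!%:R * whitney2 m lambda n k / n`!%:R.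
Proof.
move=> le_kn.
pose V n k := n`!%:R * coefs (dexp lambda 1 * u ^+ k) n / k`!%:R.
have V_spec : whitney2_spec m lambda V.
  move=> p; apply: poly_eq_nat => j.
  rewrite horner_dfact !hornerE hornerMn hornerC dfact_dexp_quotient.
  rewrite horner_sum mulr_sumr; apply: eq_bigr => i _.
  (* The [k!] in the denominator of [V] turns the falling factorial of [j] into the binomial
     coefficient. *)
  rewrite hornerZ horner_dfact hornerC hornerX dfact_nat -bin_ffact natrM /V.
  by field; rewrite fact_neq0.
have m_neq0 : m%:R != 0 :> F by rewrite -unitfE.
rewrite (whitney2_unique m_neq0 (whitney2P m lambda) V_spec) // /V.
by field; rewrite !fact_neq0.
Qed.

Lemma map_coefp_tanny_dowling k :
  map_fps (coefp k) (Fps (fun n => (n`!%:R)^-1 *: tanny_dowling m lambda n)) =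
  dexp lambda 1 * u ^+ k.
Proof.
apply/fpsP => n; transitivity ((n`!%:R)^-1 * (tanny_dowling m lambda n)`_k).
  by rewrite -coefZ.
have -> : tanny_dowling m lambda n =
    \poly_(i < n.+1) (i`!%:R * whitney2 m lambda n i) by rewrite poly_def.
rewrite coef_poly ltnS.
have [le_kn|lt_nk] := leqP k n.
  by rewrite coefs_dexp_whitney2 // [LHS]mulrC.
(* For [k > n] the polynomial has no x^k term, matching the order of [u ^+ k]. *)
by rewrite mulr0 coefs_lt_mul_exp ?dexp_quotient_coefs0.
Qed.

End WhitneyCoefs.

(** * Summation of the geometric series in x *)

Theorem theorem9 (R : realType) (m : nat) (lambda : R)
    (hm : (0 < m)%N) (hlambda : lambda != 0) :
  map_fps polyC (dexp lambda 1)
    * (1 / (1 - fpsC 'X * ((map_fps polyC (dexp lambda m%:R) - 1) / m%:R)))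
  = Fps (fun n : nat => (n`!%:R)^-1 *: tanny_dowling m lambda n)
    :> {fps {poly R}}.
Proof.
have m_unit : (m%:R : R) \is a GRing.unit by rewrite unitfE pnatr_eq0 -lt0n.
have mfps_unit : (m%:R : {fps R}) \is a GRing.unit by exact: natr_fps_unit.
pose u : {fps R} := (dexp lambda m%:R - 1) / m%:R.
have -> : (map_fps polyC (dexp lambda m%:R) - 1) / m%:R = map_fps polyC u.
  by rewrite rmorph_div // rmorphB rmorph1 rmorph_nat.
have u0 : coefs u 0 = 0 by exact: dexp_quotient_coefs0.
(* Since [u] has no constant term, 1 - x u has constant term 1 and is invertible; it is moved to the
   other side. *)
rewrite mul1r; apply: canLR (mulrK _) _.
  rewrite fps_unitE coefsB coefs1 coefsM big_ord1.
  by rewrite -[coefs (map_fps _ _) _]/((coefs u 0)%:P) u0 mulr0 subr0 unitr1.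
apply: fps_poly_eq => k.
(* Multiplying by 1 - x u makes the series telescope: at x^(k+1) the terms e_lambda u^(k+1) and
   (e_lambda u^k) u cancel, and only e_lambda survives at x^0. *)
rewrite map_coefp_polyC mulrBr mulr1 mulrCA map_coefpB map_coefpXM.
case: k => [|k]; first by rewrite map_coefp_tanny_dowling // subr0 expr0 mulr1.
by rewrite map_coefpMC !map_coefp_tanny_dowling // exprSr mulrA subrr.
Qed.
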